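(* Let $\alpha\in(0,1)$ and $\vartheta\in\Theta$. Let the multiple test procedures $\varphi_{(n)}$, $n\in\mathbb N$, be based on a critical value function $\rho\le f_\alpha^{-1}$ (i.e. on the critical values $\alpha_{i:n}=\rho(i/n)$, $i=1,\dots,n$), and assume (T2), (D3), (I1) (for every $n$) and $\lim_{n\to\infty}\zeta_n=\zeta\in[0,1]$, where $\zeta_n=n_0(n)/n$. If $\lim_{n\to\infty}R_n/n=r^*$ $P_\vartheta$-almost surely for some $r^*\in(0,f_\alpha(t_\zeta)]$, then $$\lim_{n\to\infty}\mathrm{FDR}_\vartheta(\varphi_{(n)})=\zeta\,\rho(r^* )/r^*=\zeta\,q(r^* )\le\min\{\alpha,\zeta\}.$$
   Context: Let $(\mathcal X,\mathcal A,\{P_\vartheta:\vartheta\in\Theta\})$ be a statistical experiment, $(H_i)_{i\in\mathbb N}$ a sequence of null hypotheses with $\varnothing\neq H_i\subset\Theta$, and $(p_i)_{i\in\mathbb N}$ a sequence of $p$-values, i.e. measurable maps $p_i:\mathcal X\to[0,1]$ with $0<P_\vartheta(p_i\le x)\le x$ for all $\vartheta\in H_i$, $i\in\mathbb N$, $x\in(0,1]$. Put $\mathbb N_n=\{1,\dots,n\}$, $I_0(\vartheta)=\{i\in\mathbb N:\vartheta\in H_i\}$, $I_{n,0}(\vartheta)=I_0(\vartheta)\cap\mathbb N_n$, $n_0(n)=|I_{n,0}(\vartheta)|$. A (non-randomized) multiple test procedure for $H_1,\dots,H_n$ is $\varphi_{(n)}=(\varphi_1,\dots,\varphi_n)$,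 a $\{0,1\}^n$-valued function of $p_1,\dots,p_n$, where $\varphi_i=1$ means that $H_i$ is rejected. $V_n=|\{i\in\mathbb N_n:\varphi_i=1,\ \vartheta\in H_i\}|$, $R_n=|\{i\in\mathbb N_n:\varphi_i=1\}|$, and $\mathrm{FDR}_\vartheta(\varphi_{(n)})=\mathbb E_\vartheta[V_n/(R_n\vee 1)]$. A critical value function is a nondecreasing continuous $\rho:[0,1]\to[0,1]$ with $\rho(0)=0$ and $\rho>0$ on $(0,1]$; it does not depend on $n$. $q(x)=\rho(x)/x$ for $x\in(0,1]$. Define $f_\alpha(t)=\dfrac{t}{t(1-\alpha)+\alpha}$ and its inverse $f_\alpha^{-1}(t)=\dfrac{\alpha t}{1-(1-\alpha)t}$, $t\in[0,1]$. For $\zeta\in[\alpha,1]$ let $t_\zeta=\dfrac{\alpha(1-\zeta)}{\zeta(1-\alpha)}$, and for $\zeta\in[0,\alpha)$ let $t_\zeta=1$ (so $f_\alpha(t_\zeta)=\min\{(1-\zeta)/(1-\alpha),1\}$). Conditions: (T2) For all $j\in\mathbb N_n$: $R_n=j$ implies that for all $i\in\mathbb N_n$: $\varphi_i=1\Leftrightarrow p_i\le\alpha_{j:n}$. (D3) For all $\vartheta\in\Theta$ and $i\in I_{n,0}(\vartheta)$: $p_i$ is uniformly distributed on $[0,1]$ under $P_\vartheta$. (I1) For all $\vartheta\in\Theta$: the $p_i$, $i\in I_{n,0}(\vartheta)$, are i.i.d. under $P_\vartheta$. *)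

(* Defs.v *)
From HB Require Import structures.
From mathcomp Require Export all_boot all_order all_algebra.
From mathcomp Require Export all_classical all_reals all_analysis.

Set Implicit Arguments.
Unset Strict Implicit.
Unset Printing Implicit Defensive.

Import Order.TTheory GRing.Theory Num.Theory numFieldNormedType.Exports.
Local Open Scope classical_set_scope.
Local Open Scope ring_scope.

(* Hypotheses and p-values are numbered from 0,
   so that N_n is represented by 'I_n. Critical values and rejection counts are
   not shifted: alpha_{j:n} = rho (j/n) for j = 1, ..., n. *)

Definition I0 (Theta : Type) (H : nat -> set Theta) (theta : Theta) : set nat :=
  [set i | H i theta].

Definition In0 (Theta : Type) (H : nat -> set Theta) (theta : Theta) (n : nat) :
    {set 'I_n} :=
  finset (fun i : 'I_n => `[< I0 H theta i >]).

Definition n0 (Theta : Type) (H : nat -> set Theta) (theta : Theta) (n : nat) :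
    nat :=
  #|In0 H theta n|.

Definition zeta_ (R : realType) (Theta : Type) (H : nat -> set Theta)
    (theta : Theta) (n : nat) : R :=
  (n0 H theta n)%:R / n%:R.

Definition is_pvalue (R : realType) (d : measure_display) (X : measurableType d)
    (Theta : Type) (P : Theta -> probability X R) (Hi : set Theta)
    (p_i : {mfun X >-> R}) : Prop :=
  (forall w, 0 <= p_i w <= 1) /\
  (forall theta, Hi theta -> forall x : R, 0 < x -> x <= 1 ->
    (0 < P theta [set w | p_i w <= x]%R /\ P theta [set w | p_i w <= x]%R <= x%:E)%E).

Definition unit_cube (R : realType) (n : nat) : set (n.-tuple R) :=
  [set t | forall i : 'I_n, 0 <= tnth t i <= 1].

(* Only the values of the procedure on the cube [0,1]^n matter. *)
Definition is_procedure (R : realType) (n : nat)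
    (phi : n.-tuple R -> n.-tuple bool) : Prop :=
  measurable_fun (@unit_cube R n) phi.

Definition decision (R : realType) (d : measure_display) (X : measurableType d)
    (p : nat -> {mfun X >-> R}) (n : nat) (phi : n.-tuple R -> n.-tuple bool)
    (w : X) (i : 'I_n) : bool :=
  tnth (phi [tuple p j w | j < n]) i.

Definition Rn (R : realType) (d : measure_display) (X : measurableType d)
    (p : nat -> {mfun X >-> R}) (n : nat) (phi : n.-tuple R -> n.-tuple bool)
    (w : X) : nat :=
  #|finset (fun i : 'I_n => decision p phi w i)|.

Definition Vn (R : realType) (d : measure_display) (X : measurableType d)
    (Theta : Type) (H : nat -> set Theta) (p : nat -> {mfun X >-> R})
    (theta : Theta) (n : nat) (phi : n.-tuple R -> n.-tuple bool)
    (w : X) : nat :=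
  #|finset (fun i : 'I_n => decision p phi w i && `[< H i theta >])|.

Definition FDR (R : realType) (d : measure_display) (X : measurableType d)
    (Theta : Type) (P : Theta -> probability X R) (H : nat -> set Theta)
    (p : nat -> {mfun X >-> R}) (theta : Theta) (n : nat)
    (phi : n.-tuple R -> n.-tuple bool) : \bar R :=
  ('E_(P theta)[(fun w => (Vn H p theta phi w)%:R / (maxn (Rn p phi w) 1)%:R)%R])%E.

Definition critical_value_function (R : realType) (rho : R -> R) : Prop :=
  [/\ forall x, 0 <= x <= 1 -> 0 <= rho x <= 1,
      {in `[0, 1] &, {homo rho : x y / x <= y}},
      {within `[0, 1], continuous rho},
      rho 0 = 0 &
      forall x, 0 < x <= 1 -> 0 < rho x].

Definition critical_value (R : realType) (rho : R -> R) (j n : nat) : R :=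
  rho (j%:R / n%:R).

Definition q (R : realType) (rho : R -> R) (x : R) : R := rho x / x.

Definition f_ (R : realType) (alpha t : R) : R :=
  t / (t * (1 - alpha) + alpha).

Definition f_inv (R : realType) (alpha t : R) : R :=
  alpha * t / (1 - (1 - alpha) * t).

Definition t_ (R : realType) (alpha zeta : R) : R :=
  if alpha <= zeta then alpha * (1 - zeta) / (zeta * (1 - alpha)) else 1.

Definition T2 (R : realType) (d : measure_display) (X : measurableType d)
    (p : nat -> {mfun X >-> R}) (rho : R -> R) (n : nat)
    (phi : n.-tuple R -> n.-tuple bool) : Prop :=
  forall (w : X) (j : nat), (1 <= j <= n)%N -> Rn p phi w = j ->
    forall i : 'I_n, decision p phi w i <-> p i w <= critical_value rho j n.

Definition D3 (R : realType) (d : measure_display) (X : measurableType d)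
    (Theta : Type) (P : Theta -> probability X R) (H : nat -> set Theta)
    (p : nat -> {mfun X >-> R}) (n : nat) : Prop :=
  forall (theta : Theta) (i : 'I_n), i \in In0 H theta n ->
  forall B : set R, measurable B ->
    distribution (P theta) (p i) B = uniform_prob (@ltr01 R) B.

Definition mutually_independent (R : realType) (d : measure_display)
    (X : measurableType d) (Q : probability X R) (n : nat)
    (Y : 'I_n -> {mfun X >-> R}) (I : {set 'I_n}) : Prop :=
  forall (J : {set 'I_n}) (B : 'I_n -> set R), J \subset I ->
    (forall i, measurable (B i)) ->
    Q [set w | forall i, i \in J -> B i (Y i w)] =
      (\prod_(i in J) Q (Y i @^-1` B i))%E.

Definition identically_distributed (R : realType) (d : measure_display)
    (X : measurableType d) (Q : probability X R) (n : nat)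
    (Y : 'I_n -> {mfun X >-> R}) (I : {set 'I_n}) : Prop :=
  forall i j, i \in I -> j \in I -> forall B : set R, measurable B ->
    distribution Q (Y i) B = distribution Q (Y j) B.

Definition I1 (R : realType) (d : measure_display) (X : measurableType d)
    (Theta : Type) (P : Theta -> probability X R) (H : nat -> set Theta)
    (p : nat -> {mfun X >-> R}) (n : nat) : Prop :=
  forall theta : Theta,
    mutually_independent (P theta) (fun i : 'I_n => p i) (In0 H theta n) /\
    identically_distributed (P theta) (fun i : 'I_n => p i) (In0 H theta n).

(* Main.v *)
Require Import Defs.
From mathcomp Require Import measurable_realfun ring lra.
Set Implicit Arguments.
Unset Strict Implicit.
Unset Printing Implicit Defensive.

(** Write V and R for the numbers of false and of all rejections among n
    hypotheses, r = R/n for the rejection rate, and N(x) for the number of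
    true null p-values that are at most x. By (T2), as soon as R > 0 the
    rejected hypotheses are those with p-value at most rho(r), so V =
    N(rho(r)). The numbers r converge to rstar, hence rho(r) to rho(rstar),
    and the law of large numbers gives N(x)/n -> zeta x for each fixed x.
    Hence V/n tends to zeta rho(rstar), and the false discovery proportion
    V/(R v 1) = (V/n)/r tends to zeta rho(rstar)/rstar. As it lies in [0, 1],
    its expectation converges too.

    The law of large numbers is needed at two points only: N is monotone, so
    N(rho(r)) is enclosed between N(y) and N(z) for y, z slightly below and
    above rho(rstar). The argument is quantitative and takes place in mean.
    Everywhere on the sample space, with FDP = V/(R v 1) and c = zeta
    rho(rstar)/rstar,

      rstar |FDP - c| <= |zeta_n - zeta| + eps + (1 + 1/delta) |r - rstar|
                      + |N(y)/n - zeta_n y| + |N(z)/n - zeta_n z|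

    ([FDP_dist], [Vn_dist]). The samples where r is delta-far from rstar,
    where the enclosure fails, are paid for by the term |r - rstar|/delta,
    since all fractions are at most 1. Integrating ([expected_FDP_dist]), the
    mean of |r - rstar| vanishes by dominated convergence, and each empirical
    deviation D is at most eps + D^2/eps, where D^2 has mean at most 1/n
    because pairwise independent indicators are uncorrelated
    ([null_ecount_second_moment]).

    The final bound is algebra: rho <= f_alpha^(-1) gives q(rstar) <= alpha /
    (1 - (1 - alpha) rstar), and rstar <= f_alpha(t_zeta) says exactly that
    the denominator is at least max(alpha, zeta) ([zeta_q_le]). *)

Import Order.TTheory GRing.Theory Num.Theory numFieldNormedType.Exports.
Local Open Scope classical_set_scope.
Local Open Scope ring_scope.

(** * Real-valued expectations and counts of uncorrelated events *)

Section expectations.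
Context {R : realType} {d : measure_display} {X : measurableType d}.
Context (Q : probability X R).

Lemma integrable_bounded (f : X -> R) (M : R) :
  measurable_fun setT f -> (forall w, `|f w| <= M) ->
  Q.-integrable setT (EFin \o f).
Proof.
move=> mf fM; apply: measurable_bounded_integrable => //.
  by rewrite -ge0_fin_numE// fin_num_measure.
exists M; split; first exact: num_real.
by move=> x Mx w _; exact: (le_trans (fM w) (ltW Mx)).
Qed.

Lemma Rintegral_sum (I : Type) (s : seq I) (f : I -> X -> R) :
  (forall i, Q.-integrable setT (EFin \o f i)) ->
  \int[Q]_w (\sum_(i <- s) f i w) = \sum_(i <- s) \int[Q]_w f i w.
Proof.
move=> intf; elim: s => [|i s IH].
  rewrite big_nil; under eq_Rintegral do rewrite big_nil.
  by rewrite Rintegral_cst// mul0r.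
rewrite big_cons -IH -RintegralD//.
  by apply: eq_Rintegral => w _; rewrite big_cons.
elim: s {IH} => [|j s IH].
  under eq_fun do rewrite big_nil.
  exact: finite_measure_integrable_cst.
under eq_fun do rewrite big_cons.
exact: (integrableD measurableT (intf j) IH).
Qed.

Lemma Rintegral_cst_probability (k : R) : \int[Q]_w k = k.
Proof.
by rewrite Rintegral_cst// [X in fine X](@probability_setT _ _ _ Q) mulr1.
Qed.

Lemma Rintegral_indic (A : set X) : measurable A ->
  \int[Q]_w (\1_A w) = fine (Q A).
Proof. by move=> mA; rewrite /Rintegral integral_indic// setIT. Qed.

Lemma integrable_indic_prod (A B : set X) (x y : R) :
  measurable A -> measurable B ->
  Q.-integrable setT (EFin \o (fun w => (\1_A w - x) * (\1_B w - y))).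
Proof.
move=> mA mB; apply: (@integrable_bounded _ ((1 + `|x|) * (1 + `|y|))).
  by apply: measurable_funM; apply: measurable_funB => //; exact: measurable_indic.
have h (C : set X) w (z : R) : `|\1_C w - z| <= 1 + `|z|.
  rewrite (le_trans (ler_normB _ _))// lerD2r indicE.
  by case: (_ \in _); rewrite ?normr1 ?normr0.
by move=> w; rewrite normrM ler_pM.
Qed.

Lemma covariance_indic (A B : set X) (x y z : R) :
  measurable A -> measurable B ->
  Q A = x%:E -> Q B = y%:E -> Q (A `&` B) = z%:E ->
  \int[Q]_w ((\1_A w - x) * (\1_B w - y)) = z - x * y.
Proof.
move=> mA mB QA QB QAB.
have mAB : measurable (A `&` B) by exact: measurableI.
have iI (C : set X) : measurable C ->
    Q.-integrable setT (EFin \o (fun w => \1_C w : R)).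
  move=> mC; apply: (@integrable_bounded _ 1); first exact: measurable_indic.
  by move=> w; rewrite indicE; case: (_ \in _); rewrite ?normr1 ?normr0.
have iZ (C : set X) (k : R) : measurable C ->
    Q.-integrable setT (EFin \o (fun w => k * \1_C w)).
  move=> mC; exact: (integrableZl measurableT k (iI C mC)).
have ic (k : R) : Q.-integrable setT (EFin \o (fun=> k)).
  exact: finite_measure_integrable_cst.
transitivity (\int[Q]_w ((\1_(A `&` B) w - y * \1_A w) - (x * \1_B w - x * y))).
  by apply: eq_Rintegral => w _; rewrite indicI /=; ring.
have i1 : Q.-integrable setT (EFin \o (fun w => \1_(A `&` B) w - y * \1_A w)).
  exact: (integrableB measurableT (iI _ mAB) (iZ _ y mA)).
have i2 : Q.-integrable setT (EFin \o (fun w => x * \1_B w - x * y)).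
  exact: (integrableB measurableT (iZ _ x mB) (ic _)).
rewrite !RintegralB//; [|exact: iZ|exact: iI|exact: iZ].
rewrite !RintegralZl ?Rintegral_indic//; [|exact: iI|exact: iI].
rewrite Rintegral_cst_probability QA QB QAB /=; ring.
Qed.

(** Expanding the square, independence kills the off-diagonal covariances and
    each diagonal term is a Bernoulli variance, at most 1. *)
Lemma centred_count_second_moment (I : finType) (S : {set I}) (A : I -> set X)
    (x : R) :
  (forall i, measurable (A i)) ->
  (forall i, i \in S -> Q (A i) = x%:E) ->
  (forall i j, i \in S -> j \in S -> i != j -> Q (A i `&` A j) = (x * x)%:E) ->
  \int[Q]_w ((\sum_(i in S) (\1_(A i) w - x)) ^+ 2) <= #|S|%:R.
Proof.
move=> mA QA QAA.
have intA i j := integrable_indic_prod x x (mA i) (mA j).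
have -> : \int[Q]_w ((\sum_(i in S) (\1_(A i) w - x)) ^+ 2) =
    \int[Q]_w \sum_(ij <- [seq (i, j) | i <- enum S, j <- enum S])
      (\1_(A ij.1) w - x) * (\1_(A ij.2) w - x).
  apply: eq_Rintegral => w _; rewrite big_allpairs expr2 -!big_enum mulr_suml.
  by apply: eq_bigr => i _; rewrite mulr_sumr.
rewrite Rintegral_sum; last by move=> [i j]; exact: intA.
rewrite big_allpairs big_enum -sum1_card natr_sum ler_sum// => i iS.
rewrite big_enum (bigD1 i)//= big1 ?addr0; last first.
  move=> j /andP[jS ji]; have QAij : Q (A i `&` A j) = (x * x)%:E.
    by apply: QAA => //; rewrite eq_sym.
  by rewrite (covariance_indic _ _ (QA i iS) (QA j jS) QAij)// subrr.
have QAi := QA i iS.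
rewrite (covariance_indic (z := x) _ _ QAi QAi)//; last by rewrite setIid.
rewrite lerBlDr (@le_trans _ _ 1)//.
  by rewrite -lee_fin -QAi; exact: probability_le1.
by rewrite lerDl -expr2 sqr_ge0.
Qed.
End expectations.

(** The preimage of any set is a finite union, over the bit patterns that it
    selects, of finite intersections of coordinate events. This makes every
    statistic of the vector of decisions measurable at once. *)
Lemma measurable_comp_bool_tuple {R : realType} {d : measure_display}
    {X : measurableType d} (n : nat) (f : X -> n.-tuple bool)
    (g : n.-tuple bool -> R) :
  measurable_fun setT f -> measurable_fun setT (g \o f).
Proof.
move=> /measurable_fun_tnthP mf _ B mB; rewrite setTI.
rewrite (_ : _ @^-1` B = \bigcup_(t in [set t | B (g t)])
    \bigcap_(i in @setT 'I_n) (fun w => tnth (f w) i) @^-1` [set tnth t i]).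
  apply: fin_bigcup_measurable => [|t _]; first exact: finite_finset.
  apply: fin_bigcap_measurable => [|i _]; first exact: finite_finset.
  by rewrite -[X in measurable X]setTI; exact: mf.
apply/seteqP; split => w /=; first by exists (f w).
move=> [t Bt ft]; rewrite (_ : f w = t)//.
by apply: eq_from_tnth => i; exact: ft.
Qed.

Lemma expected_distance_cvg {R : realType} {d : measure_display}
    {X : measurableType d} (Q : probability X R) (f : nat -> X -> R) (a M : R) :
  (forall n, measurable_fun setT (f n)) -> (forall n w, `|f n w| <= M) ->
  {ae Q, forall w, (fun n => f n w) @ \oo --> a} ->
  (fun n => \int[Q]_w `|f n w - a|) @ \oo --> (0 : R).
Proof.
move=> mf fM fa.
have := @dominated_convergence _ _ _ Q setT measurableT
  (fun n => EFin \o f n) (EFin \o cst a) (EFin \o cst M).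
case => //.
- by move=> n; exact/measurable_EFinP.
- by apply/measurable_EFinP; exact: measurable_cst.
- by move: fa; apply: filterS => w fwa _; apply: cvg_EFin => //; exact: nearW.
- exact: finite_measure_integrable_cst.
- by apply: aeW => w n _; rewrite lee_fin.
- by move=> _ + _ => /fine_cvg; apply: cvg_trans; apply: near_eq_cvg; near=> n.
Unshelve. all: end_near.
Qed.

(** * The true null p-values *)

Lemma uniform_prob01_le {R : realType} (x : R) : 0 <= x <= 1 ->
  uniform_prob (@ltr01 R) `]-oo, x] = x%:E.
Proof.
move=> /andP[x0 x1]; rewrite /uniform_prob integral_uniform_pdf.
rewrite (_ : _ `&` _ = `[0, x]%classic); last first.
  apply/seteqP; split=> y /=; rewrite !in_itv/=.
    by move=> [-> /andP[-> _]].
  by move=> /andP[y0 yx]; rewrite yx y0 (le_trans yx).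
rewrite (eq_integral (cst 1%E)) => [|y]; last first.
  rewrite inE/= in_itv/= => /andP[y0 yx].
  by rewrite /uniform_pdf y0 (le_trans yx x1) subr0 invr1.
rewrite integral_cst//= mul1e lebesgue_measure_itv/= lte_fin.
by case: ltgtP x0 => //= [x0 _|<- _]; rewrite ?sube0// oppr0 addr0.
Qed.

Section nulls.
Context {R : realType} {d : measure_display} {X : measurableType d}.
Context {Theta : Type} (P : Theta -> probability X R) (H : nat -> set Theta).
Context (p : nat -> {mfun X >-> R}) (theta : Theta).

(** The count N(x), kept as a sum of real indicators so that moments can be
    taken termwise. *)
Definition null_ecount (n : nat) (x : R) (w : X) : R :=
  \sum_(i in In0 H theta n) \1_[set v | p i v <= x] w.

Lemma pvalue_leE (i : nat) (x : R) : [set v | p i v <= x] = p i @^-1` `]-oo, x].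
Proof. by apply/seteqP; split => v /=; rewrite in_itv. Qed.

Lemma measurable_pvalue_le (i : nat) (x : R) : measurable [set v | p i v <= x].
Proof.
by rewrite -[X in measurable X]setTI pvalue_leE; exact: (measurable_funP (p i)).
Qed.

Lemma le_null_ecount n x y w : x <= y -> null_ecount n x w <= null_ecount n y w.
Proof.
move=> xy; apply: ler_sum => i _; rewrite !indicE ler_nat.
case: (boolP (w \in [set v | p i v <= x])) => //; rewrite inE/= => pix.
by rewrite mem_set//= (le_trans pix).
Qed.

Lemma null_ecount_bounds n x w : 0 <= null_ecount n x w <= (n0 H theta n)%:R.
Proof.
rewrite /null_ecount sumr_ge0//= /n0 -sum1_card natr_sum; apply: ler_sum => i _.
by rewrite indicE; case: (_ \in _).
Qed.

Lemma measurable_null_ecount n x : measurable_fun setT (null_ecount n x).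
Proof.
rewrite /null_ecount; under eq_fun do rewrite -big_enum.
by apply: measurable_sum => i; apply: measurable_indic; exact: measurable_pvalue_le.
Qed.

Lemma integrable_null_ecount_second_moment n x : 0 <= x <= 1 ->
  (P theta).-integrable setT
    (EFin \o (fun w => (null_ecount n x w - (n0 H theta n)%:R * x) ^+ 2)).
Proof.
move=> /andP[x0 x1]; apply: (@integrable_bounded _ _ _ _ _ ((n0 H theta n)%:R ^+ 2)).
  apply: measurable_funX; apply: measurable_funB => //.
  exact: measurable_null_ecount.
move=> w; have /andP[N0 N1] := null_ecount_bounds n x w.
have n0x : (n0 H theta n)%:R * x <= (n0 H theta n)%:R by exact: ler_piMr.
have n0x0 : 0 <= (n0 H theta n)%:R * x by exact: mulr_ge0.
have dev_le : `|null_ecount n x w - (n0 H theta n)%:R * x| <= (n0 H theta n)%:R.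
  by rewrite ler_norml; lra.
by rewrite normrX lerXn2r// nnegrE.
Qed.

Lemma null_ecount_second_moment n x : D3 P H p n -> I1 P H p n ->
  0 <= x <= 1 ->
  \int[P theta]_w ((null_ecount n x w - (n0 H theta n)%:R * x) ^+ 2) <= n%:R.
Proof.
move=> hD3 /(_ theta)[hI _] x01.
have Pp (i : 'I_n) : i \in In0 H theta n ->
    P theta [set v | p i v <= x] = x%:E.
  by move=> i0; rewrite pvalue_leE -(uniform_prob01_le x01) -(hD3 theta i i0).
apply: le_trans (_ : #|In0 H theta n|%:R <= _); last first.
  by rewrite ler_nat -[leqRHS]card_ord max_card.
have -> : (fun w => (null_ecount n x w - (n0 H theta n)%:R * x) ^+ 2) =
    fun w => (\sum_(i in In0 H theta n) (\1_[set v | p i v <= x] w - x)) ^+ 2.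
  by apply/funext => w; rewrite sumrB sumr_const mulr_natl.
apply: centred_count_second_moment => // [i|i j i0 j0 ij].
  exact: measurable_pvalue_le.
have := hI [set i; j]%SET (fun=> `]-oo, x]%classic).
rewrite big_setU1 ?inE//= big_set1 -!pvalue_leE !Pp// -EFinM => <- //.
- congr (P theta _); apply/seteqP; split => v /=.
    by move=> [pi pj] k /set2P[]->; rewrite in_itv.
  by move=> h; split; [have := h i|have := h j];
    rewrite in_itv/=; apply; rewrite ?finset.set21 ?finset.set22.
- by apply/fintype.subsetP => k /set2P[]->.
Qed.

(** * The false discovery proportion *)

Section procedure.
Context (n : nat) (phi : n.-tuple R -> n.-tuple bool).

Lemma Rn_le_size w : (Rn p phi w <= n)%N.
Proof. by rewrite -[leqRHS]card_ord max_card. Qed.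

Lemma Vn_le_Rn w : (Vn H p theta phi w <= Rn p phi w)%N.
Proof. by apply/subset_leq_card/fintype.subsetP => i; rewrite !inE => /andP[]. Qed.

Definition FDP (w : X) : R :=
  (Vn H p theta phi w)%:R / (maxn (Rn p phi w) 1)%:R.

Lemma FDP_ge0_le1 w : 0 <= FDP w <= 1.
Proof.
rewrite /FDP divr_ge0//= ler_pdivrMr ?ltr0n ?leq_max ?orbT// mul1r ler_nat.
by rewrite leq_max Vn_le_Rn.
Qed.

(** This holds even when nothing is rejected, as then V = 0; so dividing by n
    gives FDP * r = V/n on the whole sample space. *)
Lemma FDP_mul_Rn w : FDP w * (Rn p phi w)%:R = (Vn H p theta phi w)%:R.
Proof.
rewrite /FDP; case: (posnP (Rn p phi w)) => [R0|Rpos].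
  by have := Vn_le_Rn w; rewrite R0 leqn0 => /eqP->; rewrite mulr0.
by rewrite (maxn_idPl Rpos) divfK// pnatr_eq0 -lt0n.
Qed.

(** The procedure is measurable on the unit cube only, which is where the vector
    of p-values takes its values. *)
Lemma measurable_decisions : (forall i w, 0 <= p i w <= 1) -> is_procedure phi ->
  measurable_fun setT (fun w => phi [tuple p j w | j < n]).
Proof.
move=> p01 mphi.
have mp : measurable_fun setT (fun w => [tuple p j w | j < n]).
  apply/measurable_fun_tnthP => i.
  rewrite (_ : _ \o _ = p i); first exact: measurable_funP.
  by apply/funext => w /=; rewrite tnth_mktuple.
apply: (measurable_comp (F := @unit_cube R n)) => //.
  rewrite (_ : @unit_cube R n = \bigcap_(i in @setT 'I_n)
      (fun t : n.-tuple R => tnth t i) @^-1` `[0, 1]).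
    apply: fin_bigcap_measurable => [|i _]; first exact: finite_finset.
    rewrite -[X in measurable X]setTI.
    exact: (measurable_tnth i measurableT (measurable_itv _)).
  apply/seteqP; split => t /= h i; first by rewrite /= in_itv/= => _; exact: h.
  by have := h i I; rewrite /= in_itv.
by move=> _ [w _ <-] i; rewrite tnth_mktuple.
Qed.

Lemma measurable_FDP : (forall i w, 0 <= p i w <= 1) -> is_procedure phi ->
  measurable_fun setT FDP.
Proof.
move=> p01 mphi.
pose g (t : n.-tuple bool) : R :=
  #|finset (fun i : 'I_n => tnth t i && `[< H i theta >])|%:R /
  (maxn #|finset (fun i : 'I_n => tnth t i)| 1)%:R.
exact: (measurable_comp_bool_tuple g (measurable_decisions p01 mphi)).
Qed.

Lemma measurable_rejection_rate :
  (forall i w, 0 <= p i w <= 1) -> is_procedure phi ->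
  measurable_fun setT (fun w => (Rn p phi w)%:R / n%:R : R).
Proof.
move=> p01 mphi.
pose g (t : n.-tuple bool) : R :=
  #|finset (fun i : 'I_n => tnth t i)|%:R / n%:R.
exact: (measurable_comp_bool_tuple g (measurable_decisions p01 mphi)).
Qed.

(** Condition (T2) at j = R: rejection amounts to thresholding at the random
    critical value rho(R/n). The case R = 0 is excluded because (T2) does not
    cover it, and because N(rho 0) counts the p-values equal to 0. *)
Lemma Vn_null_ecount (rho : R -> R) w : T2 p rho phi -> (0 < Rn p phi w)%N ->
  (Vn H p theta phi w)%:R = null_ecount n (rho ((Rn p phi w)%:R / n%:R)) w.
Proof.
move=> hT2 Rpos.
have decE := hT2 w (Rn p phi w) _ erefl.
rewrite /Vn -sum1_card natr_sum big_mkcond/= /null_ecount [RHS]big_mkcond/=.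
apply: eq_bigr => i _; rewrite !inE/= indicE.
case: (asboolP (H i theta)) => hi; rewrite ?andbF ?andbT//.
have {}decE : decision p phi w i = (p i w <= rho ((Rn p phi w)%:R / n%:R)).
  by apply/idP/idP => /decE; apply; rewrite Rpos Rn_le_size.
by rewrite decE; case: ifPn => h; [rewrite mem_set|rewrite memNset//=; exact/negP].
Qed.

(** From FDP * r = V/n one gets
    rstar (FDP - c) = (V/n - rstar c) - FDP (r - rstar), and 0 <= FDP <= 1. *)
Lemma FDP_dist (zeta rhostar rstar : R) w : 0 < rstar ->
  rstar * `|FDP w - zeta * rhostar / rstar| <=
  `|(Vn H p theta phi w)%:R / n%:R - zeta * rhostar| +
  `|(Rn p phi w)%:R / n%:R - rstar|.
Proof.
move=> r0; have /andP[W0 W1] := FDP_ge0_le1 w.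
rewrite -[X in X * _]gtr0_norm// -normrM.
set V := (Vn _ _ _ _ _)%:R; set r := _ / _ - rstar.
rewrite (_ : rstar * _ = (V / n%:R - zeta * rhostar) - FDP w * r).
  rewrite (le_trans (ler_normB _ _))// lerD2l normrM.
  by rewrite ger0_norm// ler_piMl.
by rewrite /r /V -FDP_mul_Rn; set k := n%:R^-1; field; rewrite gt_eqF.
Qed.

(** If r is delta-close to rstar, then r > 0 since delta <= rstar, so
    V = N(rho(r)) is enclosed between N(y) and N(z). Otherwise |r - rstar|/delta
    is at least 1, which dominates the left-hand side. *)
Lemma Vn_dist (rho : R -> R) (zeta rstar eps delta y z : R) w :
  (0 < n)%N -> T2 p rho phi -> 0 <= zeta <= 1 -> 0 <= rho rstar <= 1 ->
  0 < delta <= rstar ->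
  (forall r, 0 <= r <= 1 -> `|r - rstar| < delta -> y <= rho r <= z) ->
  `|y - rho rstar| <= eps -> `|z - rho rstar| <= eps ->
  `|(Vn H p theta phi w)%:R / n%:R - zeta * rho rstar| <=
  `|zeta_ R H theta n - zeta| + eps +
  (`|null_ecount n y w / n%:R - zeta_ R H theta n * y| +
   `|null_ecount n z w / n%:R - zeta_ R H theta n * z|) +
  `|(Rn p phi w)%:R / n%:R - rstar| / delta.
Proof.
move=> npos hT2 zeta01 rho01 /andP[d0 dr] yz yeps zeps.
have nR0 : (0 : R) < n%:R by rewrite ltr0n.
set v := (Vn _ _ _ _ _)%:R / _; set r := (Rn _ _ _)%:R / _.
set Dy := `|null_ecount _ y _ / _ - _|; set Dz := `|null_ecount _ z _ / _ - _|.
set zn := zeta_ _ _ _ _; set rhos := rho rstar in rho01 yeps zeps *.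
have r01 : 0 <= r <= 1.
  by rewrite divr_ge0//= ler_pdivrMr// mul1r ler_nat Rn_le_size.
have v01 : 0 <= v <= 1.
  rewrite divr_ge0//= ler_pdivrMr// mul1r ler_nat.
  exact: leq_trans (Vn_le_Rn w) (Rn_le_size w).
have zn01 : 0 <= zn <= 1.
  rewrite divr_ge0//= ler_pdivrMr// mul1r ler_nat.
  by rewrite -[leqRHS]card_ord max_card.
have eps0 : 0 <= eps by exact: le_trans yeps.
have Dy0 : 0 <= Dy by exact: normr_ge0.
have Dz0 : 0 <= Dz by exact: normr_ge0.
case: (ltP `|r - rstar| delta) => [rd|dle]; last first.
  have : 1 <= `|r - rstar| / delta by rewrite ler_pdivlMr// mul1r.
  have : `|v - zeta * rhos| <= 1.
    have : 0 <= zeta * rhos by apply: mulr_ge0; lra.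
    have : zeta * rhos <= 1 by apply: mulr_ile1; lra.
    by rewrite ler_norml; lra.
  have := normr_ge0 (zn - zeta). lra.
have r_gt0 : 0 < r by have := rd; rewrite ltr_norml; lra.
have Rpos : (0 < Rn p phi w)%N.
  by rewrite lt0n; apply: contraL r_gt0 => /eqP R0; rewrite /r R0 mul0r ltxx.
have /andP[ylr rlz] := yz r r01 rd.
have vE : v = null_ecount n (rho r) w / n%:R by rewrite /v (Vn_null_ecount hT2).
have yv : null_ecount n y w / n%:R <= v.
  by rewrite vE ler_pM2r ?invr_gt0// le_null_ecount.
have vz : v <= null_ecount n z w / n%:R.
  by rewrite vE ler_pM2r ?invr_gt0// le_null_ecount.
have small (c t e : R) : 0 <= c <= 1 -> `|t| <= e -> `|c * t| <= e.
  move=> /andP[c0 c1] te; rewrite normrM ger0_norm//.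
  by rewrite (le_trans _ te)// ler_piMl.
have := small zn (y - rhos) eps zn01 yeps.
have := small zn (z - rhos) eps zn01 zeps.
have := small rhos (zn - zeta) `|zn - zeta| rho01 (lexx _).
have : 0 <= `|r - rstar| / delta by rewrite divr_ge0// ltW.
have := lexx Dy; rewrite {1}/Dy -/zn; have := lexx Dz; rewrite {1}/Dz -/zn.
rewrite !ler_norml. lra.
Qed.

(** The integrated form of the two preceding bounds, with n-dependence confined
    to terms that vanish as n grows. *)
Lemma expected_FDP_dist (rho : R -> R) (zeta rstar eps delta y z : R) :
  (forall i w, 0 <= p i w <= 1) -> is_procedure phi -> D3 P H p n -> I1 P H p n ->
  (0 < n)%N -> T2 p rho phi -> 0 <= zeta <= 1 -> 0 <= rho rstar <= 1 ->
  0 < delta <= rstar -> 0 < eps -> 0 <= y <= 1 -> 0 <= z <= 1 ->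
  (forall r, 0 <= r <= 1 -> `|r - rstar| < delta -> y <= rho r <= z) ->
  `|y - rho rstar| <= eps -> `|z - rho rstar| <= eps ->
  rstar * `|\int[P theta]_w FDP w - zeta * rho rstar / rstar| <=
  `|zeta_ R H theta n - zeta| + 3 * eps +
  (1 + delta^-1) * (\int[P theta]_w `|(Rn p phi w)%:R / n%:R - rstar|) +
  2 / eps * n%:R^-1.
Proof.
move=> p01 mphi hD3 hI1 npos hT2 zeta01 rho01 /andP[d0 dr] e0 y01 z01 yz yeps zeps.
have r0 : 0 < rstar by exact: lt_le_trans dr.
have nR0 : (0 : R) < n%:R by rewrite ltr0n.
set c := zeta * rho rstar / rstar.
set rate := fun w => (Rn p phi w)%:R / n%:R : R.
set S := fun x w => (null_ecount n x w - (n0 H theta n)%:R * x) ^+ 2.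
set Q := P theta.
have iFDP : Q.-integrable setT (EFin \o FDP).
  apply: (@integrable_bounded _ _ _ _ _ 1); first exact: measurable_FDP.
  by move=> w; have /andP[? ?] := FDP_ge0_le1 w; rewrite ger0_norm.
have ic k : Q.-integrable setT (EFin \o (fun=> k : R)).
  exact: finite_measure_integrable_cst.
have iFDPc : Q.-integrable setT (EFin \o (fun w => FDP w - c)).
  exact: (integrableB measurableT iFDP (ic c)).
have iFDPcn : Q.-integrable setT (EFin \o (fun w => `|FDP w - c|)).
  exact: (integrable_norm iFDPc).
have irate : Q.-integrable setT (EFin \o (fun w => `|rate w - rstar|)).
  have irate : Q.-integrable setT (EFin \o rate).
    apply: (@integrable_bounded _ _ _ _ _ 1).
      exact: measurable_rejection_rate.
    move=> w; rewrite ger0_norm ?divr_ge0// ler_pdivrMr// mul1r ler_nat.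
    exact: Rn_le_size.
  exact: (integrable_norm (integrableB measurableT irate (ic rstar))).
have iS x : 0 <= x <= 1 -> Q.-integrable setT (EFin \o S x).
  exact: integrable_null_ecount_second_moment.
(* B * S x is D^2/eps for the empirical deviation D at x: as S x has mean
   at most n, it contributes at most 1/(n eps). *)
pose B : R := (n%:R ^+ 2 * eps)^-1.
pose K : R := `|zeta_ R H theta n - zeta| + 3 * eps.
pose A : R := 1 + delta^-1.
have B0 : 0 <= B by rewrite invr_ge0 mulr_ge0 ?exprn_ge0 ?ltW.
have iZ k f : Q.-integrable setT (EFin \o f) ->
    Q.-integrable setT (EFin \o (fun w => k * f w)).
  exact: (integrableZl measurableT k).
have iD f g : Q.-integrable setT (EFin \o f) -> Q.-integrable setT (EFin \o g) ->
    Q.-integrable setT (EFin \o (fun w => f w + g w)).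
  exact: (integrableD measurableT).
have iAr := iZ A _ irate.
have iSS := iZ B _ (iD _ _ (iS _ y01) (iS _ z01)).
have iKA := iD _ _ (ic K) iAr.
have pointwise w : rstar * `|FDP w - c| <=
    (K + A * `|rate w - rstar|) + B * (S y w + S z w).
  have devE x : `|null_ecount n x w / n%:R - zeta_ R H theta n * x| <=
      eps + B * S x w.
    set D := _ / _ - _.
    have -> : B * S x w = `|D| ^+ 2 / eps.
      rewrite -normrX ger0_norm ?sqr_ge0// /B /S /D /zeta_.
      by field; rewrite !gt_eqF.
    (* D <= eps + D^2/eps: either D <= eps, or D <= D^2/eps. *)
    have [De|eD] := leP `|D| eps.
      by rewrite (le_trans De)// lerDl divr_ge0 ?sqr_ge0// ltW.
    rewrite -[leLHS]add0r; apply: lerD; first exact: ltW.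
    by rewrite ler_pdivlMr// expr2 ler_wpM2l// ltW.
  have hF := FDP_dist zeta (rho rstar) w r0.
  have hV := Vn_dist w npos hT2 zeta01 rho01 _ yz yeps zeps.
  have {}hV := hV (introT andP (conj d0 dr)).
  have hy := devE y; have hz := devE z.
  rewrite -/c -/(rate w) in hF; rewrite -/(rate w) in hV.
  have -> : A * `|rate w - rstar| = `|rate w - rstar| + `|rate w - rstar| / delta.
    by rewrite /A mulrDl mul1r mulrC.
  by rewrite [B * _]mulrDr /K; lra.
have -> : \int[Q]_w FDP w - c = \int[Q]_w (FDP w - c).
  by rewrite RintegralB// Rintegral_cst_probability.
apply: (@le_trans _ _ (\int[Q]_w (rstar * `|FDP w - c|))).
  by rewrite RintegralZl// ler_pM2l// le_normr_Rintegral.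
apply: (@le_trans _ _ (\int[Q]_w
    ((K + A * `|rate w - rstar|) + B * (S y w + S z w)))).
  by apply: le_Rintegral => //; [exact: iZ|exact: iD].
rewrite RintegralD// RintegralD// Rintegral_cst_probability !RintegralZl//; last first.
  exact: iD (iS _ y01) (iS _ z01).
rewrite lerD2l RintegralD//; [|exact: iS|exact: iS].
have Sy := null_ecount_second_moment hD3 hI1 y01.
have Sz := null_ecount_second_moment hD3 hI1 z01.
rewrite (_ : 2 / eps * n%:R^-1 = B * (n%:R + n%:R)).
  by rewrite ler_wpM2l// lerD.
by rewrite /B; field; rewrite !gt_eqF.
Qed.

End procedure.
End nulls.


(** * The bound on the limit *)

Lemma f_tE (R : realType) (alpha zeta : R) : 0 < alpha < 1 ->
  f_ alpha (t_ alpha zeta) =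
  if alpha <= zeta then (1 - zeta) / (1 - alpha) else 1.
Proof.
move=> /andP[a0 a1]; rewrite /f_ /t_; case: leP => [az|_].
  by field; rewrite !gt_eqF//; lra.
by rewrite !mul1r subrK invr1.
Qed.

Lemma f_t_le1 (R : realType) (alpha zeta : R) : 0 < alpha < 1 -> zeta <= 1 ->
  f_ alpha (t_ alpha zeta) <= 1.
Proof.
move=> a01 z1; rewrite f_tE//; case: ifPn => // az; have /andP[a0 a1] := a01.
by rewrite ler_pdivrMr ?subr_gt0//; lra.
Qed.

(** With D = 1 - (1 - alpha) rstar, the bound on rho gives q(rstar) <= alpha/D. If
    alpha <= zeta then rstar <= (1 - zeta)/(1 - alpha) means zeta <= D, so
    zeta alpha/D <= alpha; otherwise rstar <= 1 means alpha <= D, so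
    zeta alpha/D <= zeta. *)
Lemma zeta_q_le (R : realType) (alpha zeta rstar : R) (rho : R -> R) :
  0 < alpha < 1 -> 0 <= zeta <= 1 -> rho rstar <= f_inv alpha rstar ->
  0 < rstar <= f_ alpha (t_ alpha zeta) ->
  zeta * q rho rstar <= Num.min alpha zeta.
Proof.
move=> a01 /andP[z0 z1] rho_le; rewrite f_tE// => /andP[r0 r_le].
have /andP[a0 a1] := a01.
pose D := 1 - (1 - alpha) * rstar.
have qD : 0 < D -> q rho rstar <= alpha / D.
  move=> D0; rewrite /q ler_pdivrMr// (le_trans rho_le)// /f_inv -/D.
  by rewrite mulrAC.
move: r_le; case: (leP alpha zeta) => [az|za] r_le.
  rewrite ler_pdivlMr ?subr_gt0// in r_le.
  have zD : zeta <= D by rewrite /D; lra.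
  have D0 : 0 < D by lra.
  rewrite (le_trans (ler_wpM2l z0 (qD D0)))// mulrA ler_pdivrMr// mulrC.
  by rewrite ler_wpM2l// ltW.
have aD : alpha <= D by rewrite /D; nra.
have D0 : 0 < D by lra.
rewrite (le_trans (ler_wpM2l z0 (qD D0)))// mulrA ler_pdivrMr//.
by rewrite ler_wpM2l.
Qed.

(** * Convergence of the false discovery rate *)

Lemma continuous_within_ball (R : realType) (f : R -> R) (a b x e : R) :
  {within `[a, b], continuous f} -> a <= x <= b -> 0 < e ->
  exists2 delta, 0 < delta &
    forall y, a <= y <= b -> `|y - x| < delta -> `|f y - f x| <= e.
Proof.
move=> /subspace_continuousP/(_ x) + xab e0; rewrite /= in_itv/=.
move=> /(_ xab)/cvgrPdist_le/(_ _ e0)[delta/= delta0 fdelta].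
exists delta => // y yab yx; rewrite distrC; apply: fdelta.
  by rewrite /= distrC.
by rewrite /= in_itv.
Qed.

(** A bound that tends to e for each e > 0 is eventually at most 2 e, so it
    suffices to take e proportional to the required accuracy. *)
Lemma cvg_of_scaled_dist_le (R : realType) (u : nat -> R) (l k : R) : 0 < k ->
  (forall e, 0 < e -> exists2 v : nat -> R, v @ \oo --> (e : R) &
     \forall n \near \oo, k * `|u n - l| <= v n) ->
  u @ \oo --> l.
Proof.
move=> k0 uv; apply/cvgrPdist_le => /= e e0.
have e'0 : 0 < k * e / 2 by rewrite divr_gt0// mulr_gt0.
have [v /cvgrPdist_lt /(_ _ e'0) ve uv'] := uv _ e'0.
near=> n.
have h1 : k * `|u n - l| <= v n by near: n.
have h2 : `|k * e / 2 - v n| < k * e / 2 by near: n.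
rewrite distrC -(ler_pM2l k0) (le_trans h1)//.
by move: h2; rewrite ltr_norml; lra.
Unshelve. all: end_near. Qed.

Theorem theorem5p2 (R : realType) (d : measure_display) (X : measurableType d)
  (Theta : Type) (P : Theta -> probability X R)
  (H : nat -> set Theta) (hH : forall i, H i !=set0)
  (p : nat -> {mfun X >-> R}) (hp : forall i, is_pvalue P (H i) (p i))
  (alpha : R) (halpha : 0 < alpha < 1) (theta : Theta)
  (rho : R -> R) (hrho : critical_value_function rho)
  (hrho_le : forall x, 0 <= x <= 1 -> rho x <= f_inv alpha x)
  (phi : forall n : nat, n.-tuple R -> n.-tuple bool)
  (hphi : forall n, is_procedure (phi n))
  (hT2 : forall n, T2 p rho (phi n))
  (hD3 : forall n, D3 P H p n)
  (hI1 : forall n, I1 P H p n)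
  (zeta : R) (hzeta : 0 <= zeta <= 1)
  (hzeta_lim : (fun n : nat => zeta_ R H theta n) @ \oo --> zeta)
  (rstar : R) (hrstar : 0 < rstar <= f_ alpha (t_ alpha zeta))
  (hRn : {ae P theta, forall w,
     (fun n : nat => (Rn p (phi n) w)%:R / n%:R : R) @ \oo --> rstar}) :
  (fun n : nat => FDR P H p theta (phi n)) @ \oo
      --> (zeta * rho rstar / rstar)%:E /\
  zeta * rho rstar / rstar = zeta * q rho rstar /\
  zeta * q rho rstar <= Num.min alpha zeta.
Proof.
have [rho01 rho_homo rho_cont _ _] := hrho.
have p01 i w : 0 <= p i w <= 1 by have [h _] := hp i; exact: h.
have /andP[r0 r_le] := hrstar; have /andP[z0 z1] := hzeta.
have r1 : rstar <= 1 by apply: (le_trans r_le); exact: f_t_le1.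
have rr01 : 0 <= rstar <= 1 by rewrite ltW.
have rhor01 := rho01 _ rr01.
split; last first.
  split; first by rewrite mulrA.
  exact: (zeta_q_le halpha hzeta (hrho_le _ rr01)).
have FDRE n : FDR P H p theta (phi n) =
    (\int[P theta]_w FDP H p theta (phi n) w)%:E.
  rewrite /FDR unlock /Rintegral fineK//.
  apply: integrable_fin_num => //.
  apply: (@integrable_bounded _ _ _ _ _ 1); first exact: measurable_FDP.
  by move=> w; have /andP[? ?] := FDP_ge0_le1 H p theta (phi n) w; rewrite ger0_norm.
under eq_fun do rewrite FDRE.
apply: cvg_EFin; first exact: nearW.
apply: (@cvg_of_scaled_dist_le _ _ _ rstar r0) => e e0.
have e3 : 0 < e / 3 by rewrite divr_gt0.
have [delta0 delta0_gt0 rho_near] := continuous_within_ball rho_cont rr01 e3.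
pose delta := Num.min delta0 rstar.
have delta_gt0 : 0 < delta by rewrite lt_min delta0_gt0.
(* The truncation to [0, 1] keeps y and z in the range where the uniform
   distribution function is the identity. *)
pose y := Num.max 0 (rho rstar - e / 3).
pose z := Num.min 1 (rho rstar + e / 3).
pose rate n w : R := (Rn p (phi n) w)%:R / n%:R.
have rate_le1 n w : `|rate n w| <= 1.
  rewrite ger0_norm ?divr_ge0//; have [->|n0] := posnP n.
    by rewrite /rate invr0 mulr0.
  by rewrite ler_pdivrMr ?ltr0n// mul1r ler_nat Rn_le_size.
have rate_cvg : (fun n => \int[P theta]_w `|rate n w - rstar|) @ \oo --> (0 : R).
  apply: (expected_distance_cvg _ rate_le1 hRn) => n.
  exact: measurable_rejection_rate.
exists (fun n => `|zeta_ R H theta n - zeta| + 3 * (e / 3) +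
  (1 + delta^-1) * (\int[P theta]_w `|rate n w - rstar|) +
  2 / (e / 3) * n%:R^-1).
  rewrite [X in _ --> X](_ : e = `|zeta - zeta| + 3 * (e / 3) +
    (1 + delta^-1) * 0 + 2 / (e / 3) * 0); last first.
    by rewrite subrr normr0 !mulr0 !addr0 add0r mulrC divfK.
  apply: cvgD; last first.
    apply: cvgM; first exact: cvg_cst.
    by rewrite -cvg_shiftS; exact: cvg_harmonic.
  apply: cvgD; last by apply: cvgM => //; exact: cvg_cst.
  apply: cvgD; last exact: cvg_cst.
  by apply: cvg_norm; apply: cvgB => //; exact: cvg_cst.
near=> n.
have n0 : (0 < n)%N by near: n; exact: nbhs_infty_gt.
apply: (@expected_FDP_dist _ _ _ _ _ _ _ _ _ _ rho zeta rstar (e / 3) delta y z) => //.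
- by rewrite delta_gt0 ge_min lexx orbT.
- by rewrite /y; have [] := lerP 0 (rho rstar - e / 3); lra.
- by rewrite /z; have [] := lerP 1 (rho rstar + e / 3); lra.
- move=> r r01; rewrite lt_min => /andP[rd _].
  have := rho_near r r01 rd; have /andP[? ?] := rho01 r r01.
  by rewrite ler_norml ge_max le_min => /andP[? ?]; lra.
- by rewrite /y ler_norml; have [] := lerP 0 (rho rstar - e / 3); lra.
- by rewrite /z ler_norml; have [] := lerP 1 (rho rstar + e / 3); lra.
Unshelve. all: end_near.
Qed.
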